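(* There exist absolute constants $\kappa_1,\kappa_2,c_1,c_2,C>0$ such that if $p\ge5$ and $$\kappa_1\log(p)\sqrt p\le m\le\kappa_2\,p\,(\log p)^{-1},$$ then there exists an event of probability larger than $1-C/p$ on which, for all $k\in\{0,\dots,p-1\}$, $$c_1\left(\frac{x^*_k\log p}{m}+\frac{\log p}{p}\sum_{u\ne k}x^*_u+\frac{\log^2p}{m^2}\right)\le d_k^2\le c_2\left(\frac{x^*_k\log p}{m}+\frac{\log^2p}{p}\sum_{u\neq k}x^*_u+\frac{\log^4p}{m^2}\right),$$ where $$d_k=\sqrt{4\log p}\left[\sqrt{\langle V_k,Y\rangle+\frac{5B^2\log p}{3}}+\sqrt{B^2\log p}\right]+\frac{2B\log p}{3}.$$
   Context: Random convolution model: $p,m$ are positive integers, vectors in $\mathbb{R}^p$ are indexed by $\{0,\dots,p-1\}$ and indices are understood modulo $p$. $U_1,\dots,U_m$ are i.i.d. uniform on $\{0,\dots,p-1\}$; for $k\in\mathbb{Z}$, $\mathbb{N}(k)=\mathrm{card}\{i:U_i\equiv k\bmod p\}$; $A\in\mathbb{R}^{p\times p}$ is given by $A_{\ell,k}=\mathbb{N}(\ell-k)$. The vector $x^*\in\mathbb{R}_+^p$ is $s$-sparse for some $1\le s<\min(m,p)$. Conditionally on $U_1,\dots,U_m$, the entries of $Y$ are independent with $Y_\ell\sim\mathrm{Poisson}((Ax^* )_\ell)$. Further, $$V_{k,\ell}=\left(\frac{\mathbb{N}(\ell-k)-\frac{m-1}{p}}{m}\right)^2,\quad V_k=(V_{k,\ell})_\ell,\quad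 \langle V_k,Y\rangle=\sum_\ell V_{k,\ell}Y_\ell,\qquad B=\max_{u\in\{0,\dots,p-1\}}\frac1m\left|\mathbb{N}(u)-\frac{m-1}{p}\right| .$$ *)

(* Defs.v *)
From HB Require Import structures.
From mathcomp Require Import all_boot all_order all_algebra.
From mathcomp Require Import all_classical all_reals all_analysis.

Set Implicit Arguments.
Unset Strict Implicit.
Unset Printing Implicit Defensive.

Import Order.TTheory GRing.Theory Num.Theory.

Local Open Scope classical_set_scope.
Local Open Scope ring_scope.

Section Probability.
Context {d : measure_display} {T : measurableType d} {R : realType}.

(* Mutual independence is stated for a set function, so that it applies both
   to [P] and to the conditional probability [cond_prob P E]. *)
Definition mutually_independent {d' : measure_display}
    {T' : measurableType d'} {I : finType}
    (mu : set T -> \bar R) (X : I -> T -> T') : Prop :=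
  forall (J : {set I}) (B : I -> set T'), (forall i, measurable (B i)) ->
    mu (\bigcap_(i in [set` J]) (X i @^-1` B i)) =
    (\prod_(i in J) mu (X i @^-1` B i))%E.

(* Only meaningful when [0 < P E]. *)
Definition cond_prob (P : probability T R) (E A : set T) : \bar R :=
  (fine (P (A `&` E)) / fine (P E))%:E.

(* A nat-valued variable with this property lies almost surely in
   {0, ..., p - 1}. *)
Definition uniform_below (P : probability T R) (p : nat)
    (X : {RV P >-> nat}) : Prop :=
  forall v : nat, (v < p)%N -> distribution P X [set v] = (p%:R^-1)%:E.

End Probability.

Section Convolution.
Context {R : realType} (p m : nat).

(* [u] is a realization of (U_1, ..., U_m). *)
Implicit Types (u : 'I_m -> nat) (y : 'I_p -> nat) (k l : 'I_p).

Definition count_mod u (k : int) : nat :=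
  #|[pred i : 'I_m | ((u i)%:Z == k %[mod p%:Z])%Z]|.

Definition conv_mx u : 'M[R]_p :=
  \matrix_(l, k) (count_mod u (l%:Z - k%:Z))%:R.

Definition Vweight u k l : R :=
  (((count_mod u (l%:Z - k%:Z))%:R - (m%:R - 1) / p%:R) / m%:R) ^+ 2.

(* Starting the maximum at 0 is harmless: all the terms are nonnegative. *)
Definition Bmax u : R :=
  \big[Num.max/0]_(v < p)
    (m%:R^-1 * `|(count_mod u v%:Z)%:R - (m%:R - 1) / p%:R|).

Definition Vdot u y k : R := \sum_(l < p) Vweight u k l * (y l)%:R.

Definition dweight u y k : R :=
  let L := ln (p%:R : R) in
  let B := Bmax u in
  Num.sqrt (4 * L) *
    (Num.sqrt (Vdot u y k + 5 * B ^+ 2 * L / 3) + Num.sqrt (B ^+ 2 * L))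
  + 2 * B * L / 3.

Definition sparse (s : nat) (x : 'cV[R]_p) : Prop :=
  (#|[pred k : 'I_p | x k 0 != 0 :> R]%R| <= s)%N.

End Convolution.

Arguments conv_mx R {p m} u.
Arguments dweight R {p m} u y k.

Section Model.
Context {d : measure_display} {T : measurableType d} {R : realType}.
Variables (P : probability T R) (p m : nat).

Definition iid_uniform (U : 'I_m -> {RV P >-> nat}) : Prop :=
  (forall i, uniform_below p (U i)) /\
  mutually_independent P (fun i => U i : T -> nat).

(* Conditioning on the discrete vector (U_1, ..., U_m) is conditioning on each
   of its values [u] of positive probability. [poisson_prob] ignores its
   second argument, and [poisson_prob 0 _] is the Dirac mass at 0. *)
Definition cond_indep_poisson (x : 'cV[R]_p)
    (U : 'I_m -> {RV P >-> nat}) (Y : 'I_p -> {RV P >-> nat}) : Prop :=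
  forall u : 'I_m -> nat,
    let E := [set w | forall i, U i w = u i] in
    (0 < P E)%E ->
    mutually_independent (cond_prob P E) (fun l => Y l : T -> nat) /\
    forall (l : 'I_p) (S : set nat),
      cond_prob P E (Y l @^-1` S) =
      poisson_prob ((conv_mx R u *m x) l 0) 0%N S.

End Model.

(* Main.v *)
Require Import Defs.
From HB Require Import structures.
From mathcomp Require Import all_boot all_order all_algebra.
From mathcomp Require Import all_classical all_reals all_analysis.
From mathcomp Require Import ring lra.

(** With [L = ln p] and [B = Bmax], the square of the threshold [d_k] lies between
fixed multiples of [L * <V_k, Y> + B^2 * L^2] ([threshold_sqr_bounds]).  So everything comes down to the size of [B] and
of [<V_k, Y>].

Conditionally on the shifts [U], the variable [<V_k, Y>] is a linear
combination of independent Poisson variables with coefficients in [[0, B^2]].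
Chernoff's bound shows that, up to an error of order [B^2 * L], it is
comparable to its mean, with failure probability [2 / p^2]
([poisson_upper_tail], [poisson_lower_tail]); the error is absorbed by the
term [B^2 * L^2] of [d_k^2], and a union bound over [k] is affordable.  The
mean is [\sum_v x_v * response k v], where [response k v] is
[\sum_l V_{k,l} N(l - v)], so only occupancy counts [N] are left.

For these, four quantities matter:
- [max N <= 4 L], which gives [B <= 4 L / m], while a nonempty cell gives
  [B >= 1 / (2 m)];
- [\sum N^2] and [\sum N^3], which are [O(m)]: the cubes control
  [response k k], of order [1 / m], without any loss of logarithms;
- the autocorrelations [\sum_a N(a) N(a + v)] for [v != 0], of order
  [m^2 / p]: they control [response k v], between constant multiples of
  [1 / p] and of [L / p].
The sum of squares only serves to control that of cubes; the other bounds make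
up [well_spread].

All four are sums of increments as the shifts are revealed one at a time, and
each increment has a small conditional mean and a bounded size as long as the
counts seen so far are low.  The exponential of such a sum, multiplied by the
indicator that the counts are still low, is a supermartingale up to a
deterministic factor ([exp_supermartingale]); since low counts are inherited by initial segments,
no stopping time is needed.  This one lemma yields every tail bound on [U].
The maximum comes first, then squares (on the event of low maximum), then
cubes (on the event of low squares), and the autocorrelations.  Here
[m >= kappa1 * L * sqrt p] makes [m^2 / (p L)] and [m / L^2] larger than [L].

All probabilities are finite sums.  The shifts are uniform over finitely many
configurations, and the counts [Y] may be truncated at a level exceeded with
probability at most [1 / p].  The event is then a finite union of atoms
[U = t, Y = y], of known mass ([prob_atom], [prob_good_atoms]). *)

Set Implicit Arguments.
Unset Strict Implicit.
Unset Printing Implicit Defensive.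

Import Order.TTheory GRing.Theory Num.Theory.

Local Open Scope classical_set_scope.
Local Open Scope ring_scope.

(** * Exponential inequalities *)

Section Exponential.
Context {R : realType}.
Implicit Type x : R.

Lemma expR_le_1D2x x : 0 <= x <= 2^-1 -> expR x <= 1 + 2 * x.
Proof.
move=> /andP[x0 x1].
have e1 := expR_ge1Dx (- x).
have e2 := expRxMexpNx_1 x.
have e3 := expR_gt0 x.
have : expR x * (1 - x) <= expR x * expR (- x) by rewrite ler_pM2l.
rewrite e2.
nra.
Qed.

Lemma expRN_le_1Bhalf x : 0 <= x <= 1 -> expR (- x) <= 1 - x / 2.
Proof.
move=> /andP[x0 x1].
have e1 := expR_ge1Dx x.
have e2 := expRxMexpNx_1 x.
have e3 := expR_gt0 (- x).
have : (1 + x) * expR (- x) <= expR x * expR (- x) by rewrite ler_pM2r.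
rewrite e2.
nra.
Qed.

Lemma expR1_le4 : expR 1 <= 4 :> R.
Proof.
have := @expR_le_1D2x 2^-1.
have -> : expR 1 = expR 2^-1 * expR 2^-1 :> R by rewrite -expRD; congr expR; lra.
have := expR_gt0 (2^-1 : R).
move=> h0 /(_ _) h; have {}h : expR 2^-1 <= 1 + 2 * 2^-1 :> R by apply: h; lra.
nra.
Qed.

End Exponential.

(** * Exponential supermartingales on words *)

Section Supermartingale.
Context {R : realType} {A : finType}.

Lemma sum_tuple_cons (V : nmodType) n (F : n.+1.-tuple A -> V) :
  \sum_t F t = \sum_a \sum_(s : n.-tuple A) F [tuple of a :: s].
Proof.
rewrite pair_big /=.
rewrite (reindex (fun q : A * n.-tuple A => [tuple of q.1 :: q.2])) //=.
exists (fun t => (thead t, [tuple of behead t])).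
  by move=> [a s] _ /=; congr (_, _); apply/val_inj.
by move=> t _; rewrite [RHS]tuple_eta.
Qed.

(** The letters of a uniform word are revealed from right to left, so the word
already seen is the tail [s] and the next letter is its head.  As [G] passes
from [a :: s] to [s], the product of [expR (T s)] with the indicator of [G]
grows by a factor at most [expR (c (size s))] on average over the new letter;
the bound follows by induction. *)
Lemma exp_supermartingale (T : seq A -> R) (G : pred (seq A)) (c : nat -> R) n :
  (forall a s, G (a :: s) -> G s) ->
  (forall s, (size s < n)%N -> G s ->
     \sum_a expR (T (a :: s) - T s) <= #|A|%:R * expR (c (size s))) ->
  \sum_(t : n.-tuple A | G t) expR (T t)
    <= #|A|%:R ^+ n * expR (\sum_(j < n) c j + T [::]).
Proof.
move=> GS; elim: n => [|n IH] step.
  rewrite expr0 mul1r big_ord0 add0r big_mkcond /= (big_pred1 [tuple]); last first.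
    by move=> t; apply/esym/eqP; exact: tuple0.
  by case: ifP => // _; rewrite expR_ge0.
have {}IH := IH (fun s hs => step s (ltnW hs)).
rewrite big_mkcond sum_tuple_cons exchange_big /=.
apply: (@le_trans _ _ (\sum_(s : n.-tuple A | G s)
    #|A|%:R * expR (c n) * expR (T s))).
  rewrite [leRHS]big_mkcond /=; apply: ler_sum => s _.
  case: ifPn => Gs; last first.
    rewrite big1 // => a _; case: ifP => // /GS Gs'; by rewrite Gs' in Gs.
  have hs : (size s < n.+1)%N by rewrite size_tuple.
  have := step s hs Gs; rewrite size_tuple => h.
  apply: (@le_trans _ _ ((\sum_a expR (T (a :: s) - T s)) * expR (T s))).
    rewrite mulr_suml; apply: ler_sum => a _.
    rewrite -expRD subrK; case: ifP => // _; exact: expR_ge0.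
  by rewrite ler_pM2r // expR_gt0.
rewrite -mulr_sumr big_ord_recr /=.
apply: (le_trans (ler_wpM2l _ IH)).
  by rewrite mulr_ge0 // expR_ge0.
rewrite exprS !expRD le_eqVlt; apply/orP; left; apply/eqP; ring.
Qed.

(** Markov's inequality for the exponential of [T], as a count of words. *)
Lemma exp_tail (T : seq A -> R) (G : pred (seq A)) (c : nat -> R) n (tau : R) :
  (forall a s, G (a :: s) -> G s) ->
  (forall s, (size s < n)%N -> G s ->
     \sum_a expR (T (a :: s) - T s) <= #|A|%:R * expR (c (size s))) ->
  #|[pred t : n.-tuple A | G t & tau <= T t]|%:R
    <= #|A|%:R ^+ n * expR (\sum_(j < n) c j + T [::] - tau).
Proof.
move=> GS step; have := exp_supermartingale GS step.
rewrite [in X in _ -> _ <= X]expRD mulrA => h.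
apply: le_trans (ler_wpM2r (expR_ge0 _) h).
rewrite mulr_suml -sum1_card natr_sum /= big_mkcondr /=.
apply: ler_sum => t _.
rewrite -expRD; case: ifP => ht; last exact: expR_ge0.
by rewrite -expR0 ler_expR subr_ge0.
Qed.

(** Chernoff's upper tail: small exponents satisfy [expR z <= 1 + 2 z], hence the
conditional mean [w] of an increment enters with a factor [2]. *)
Lemma upper_tail (T : seq A -> R) (G : pred (seq A)) n (la w tau : R) :
  0 <= la -> T [::] = 0 ->
  (forall a s, G (a :: s) -> G s) ->
  (forall s a, (size s < n)%N -> G s -> 0 <= T (a :: s) - T s) ->
  (forall s a, (size s < n)%N -> G s -> la * (T (a :: s) - T s) <= 2^-1) ->
  (forall s, (size s < n)%N -> G s ->
     \sum_a (T (a :: s) - T s) <= #|A|%:R * w) ->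
  #|[pred t : n.-tuple A | G t & tau <= T t]|%:R
    <= #|A|%:R ^+ n * expR (la * (2 * w * n%:R - tau)).
Proof.
move=> la0 T0 GS W0 W1 Ws.
have [->|la_neq0] := eqVneq la 0.
  rewrite mul0r expR0 mulr1 -natrX -card_tuple ler_nat max_card //.
have la_gt0 : 0 < la by rewrite lt_def la_neq0.
have step s : (size s < n)%N -> G s ->
    \sum_a expR (la * T (a :: s) - la * T s) <= #|A|%:R * expR (2 * la * w).
  move=> hs Gs; apply: (@le_trans _ _ (\sum_a (1 + 2 * la * (T (a :: s) - T s)))).
    apply: ler_sum => a _; rewrite -mulrBr -mulrA; apply: expR_le_1D2x.
    by rewrite mulr_ge0 ?W0 //= W1.
  rewrite big_split /= -mulr_sumr sumr_const.
  have := Ws s hs Gs => h.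
  apply: (@le_trans _ _ (#|A|%:R * (1 + 2 * la * w))).
    rewrite mulrDr mulr1 lerD2l mulrCA ler_pM2l //; lra.
  by apply: ler_wpM2l => //; exact: expR_ge1Dx.
have := @exp_tail (fun s => la * T s) G (fun=> 2 * la * w) n (la * tau) GS step.
rewrite T0 mulr0 addr0 sumr_const card_ord.
have -> : 2 * la * w *+ n - la * tau = la * (2 * w * n%:R - tau).
  by rewrite -mulr_natr; ring.
apply: le_trans; rewrite ler_nat; apply/subset_leq_card/fintype.subsetP => t.
by rewrite !inE => /andP[-> /=]; rewrite ler_pM2l.
Qed.

(** The lower tail, from [expR (- z) <= 1 - z / 2].  The lower bound [w] on the
conditional means may depend on the length of the word: an autocorrelation
grows faster and faster, and a bound uniform in time would be trivial. *)
Lemma lower_tail (T : seq A -> R) (G : pred (seq A)) (w : nat -> R) n (la tau : R) :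
  0 < la -> T [::] = 0 ->
  (forall a s, G (a :: s) -> G s) ->
  (forall s a, (size s < n)%N -> G s -> 0 <= T (a :: s) - T s) ->
  (forall s a, (size s < n)%N -> G s -> la * (T (a :: s) - T s) <= 1) ->
  (forall s, (size s < n)%N -> G s ->
     #|A|%:R * w (size s) <= \sum_a (T (a :: s) - T s)) ->
  #|[pred t : n.-tuple A | G t & T t <= tau]|%:R
    <= #|A|%:R ^+ n * expR (la * (tau - (\sum_(j < n) w j) / 2)).
Proof.
move=> la_gt0 T0 GS W0 W1 Ws.
have step s : (size s < n)%N -> G s ->
    \sum_a expR (- la * T (a :: s) - - la * T s)
      <= #|A|%:R * expR (- la / 2 * w (size s)).
  move=> hs Gs.
  apply: (@le_trans _ _ (\sum_a (1 - la / 2 * (T (a :: s) - T s)))).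
    apply: ler_sum => a _; rewrite -mulrBr mulNr.
    rewrite (_ : la / 2 * _ = la * (T (a :: s) - T s) / 2); last by ring.
    by apply: expRN_le_1Bhalf; rewrite W1 // mulr_ge0 ?W0 // ltW.
  rewrite big_split /= sumrN -mulr_sumr sumr_const.
  have := Ws s hs Gs => h.
  apply: (@le_trans _ _ (#|A|%:R * (1 + - la / 2 * w (size s)))).
    rewrite mulrDr mulr1 lerD2l mulNr mulNr mulrN lerN2.
    by rewrite mulrCA ler_pM2l //; lra.
  by apply: ler_wpM2l => //; exact: expR_ge1Dx.
have := @exp_tail (fun s => - la * T s) G (fun j => - la / 2 * w j) n (- la * tau) GS step.
rewrite T0 mulr0 addr0 -mulr_sumr.
have -> : - la / 2 * \sum_(i < n) w i - - la * tau =
  la * (tau - (\sum_(i < n) w i) / 2) by ring.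
apply: le_trans; rewrite ler_nat; apply/subset_leq_card/fintype.subsetP => t.
by rewrite !inE => /andP[-> /=]; rewrite !mulNr lerN2 ler_pM2l.
Qed.

End Supermartingale.

(** * Occupancy counts *)

Lemma card_exists_le (T I : finType) (Q : I -> pred T) :
  (#|[pred t | [exists i, Q i t]]| <= \sum_i #|Q i|)%N.
Proof.
rewrite -sum1_card big_mkcond /=.
under [X in (_ <= X)%N]eq_bigr do rewrite -sum1_card big_mkcond /=.
rewrite exchange_big /=; apply: leq_sum => t _.
rewrite inE; case: ifP => // /existsP[i Qi].
by rewrite (bigD1 i) //= /in_mem /= Qi leq_addr.
Qed.

Lemma card_or_le (T : finType) (P Q : pred T) :
  (#|[pred t | P t || Q t]| <= #|P| + #|Q|)%N.
Proof. by rewrite -cardUI leq_addr. Qed.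

Section Occupancy.
Context {R : realType} {A : finZmodType}.
Implicit Types (s : seq A) (a b v : A).

Definition occ s a : R := (count_mem a s)%:R.

Lemma occ_cons b s a : occ (b :: s) a = (b == a)%:R + occ s a.
Proof. by rewrite /occ /= natrD. Qed.

Lemma occ_ge0 s a : 0 <= occ s a. Proof. exact: ler0n. Qed.

Lemma sum_occ s : \sum_a occ s a = (size s)%:R.
Proof.
elim: s => [|b s IH]; first by rewrite big1.
under eq_bigr do rewrite occ_cons.
rewrite big_split /= IH -natr_sum (bigD1 b) //= eqxx big1 ?addn0 -?natrD ?add1n //.
by move=> i; rewrite eq_sym => /negbTE ->.
Qed.

Definition power_sum q s : R := \sum_a occ s a ^+ q.

Lemma power_sum_cons q b s :
  power_sum q (b :: s) - power_sum q s = (occ s b + 1) ^+ q - occ s b ^+ q.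
Proof.
rewrite /power_sum -sumrB (bigD1 b) //= big1 ?addr0.
  by rewrite occ_cons eqxx [true%:R + _]addrC.
by move=> a; rewrite eq_sym occ_cons => /negbTE ->; rewrite add0r subrr.
Qed.

Lemma power_sum_nil q : power_sum q.+1 [::] = 0.
Proof. by rewrite /power_sum big1 // => a _; rewrite /occ expr0n. Qed.

Definition autocorr v s : R := \sum_a occ s a * occ s (a + v).

(** A new ball in cell [b] meets the balls of [b + v] and those of [b - v].  It
does not meet itself because [v != 0]: this is why an increment depends on the
past only through the counts, linearly. *)
Lemma autocorr_cons v b s : v != 0 ->
  autocorr v (b :: s) - autocorr v s = occ s (b + v) + occ s (b - v).
Proof.
move=> v0; rewrite /autocorr -sumrB.
have bv : (b == b - v) = false.
  by rewrite -subr_eq0 opprB addrC subrK; apply/negbTE.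
have bv' : (b == b + v) = false.
  by rewrite -subr_eq0 opprD addrA subrr sub0r oppr_eq0; apply/negbTE.
rewrite (bigD1 b) //= (bigD1 (b - v)) ?(eq_sym (b - v)) ?bv //= big1 => [|a].
  by rewrite !occ_cons subrK eqxx bv bv' /=; ring.
rewrite !occ_cons => /andP[ab abv].
have -> : (b == a) = false by rewrite eq_sym; apply/negbTE.
have -> : (b == a + v) = false by rewrite -subr_eq eq_sym; apply/negbTE.
by rewrite !add0r subrr.
Qed.

Lemma autocorr_nil v : autocorr v [::] = 0.
Proof. by rewrite /autocorr big1 // => a _; rewrite /occ mul0r. Qed.

Lemma sum_occ_shift s v : \sum_b occ s (b + v) = (size s)%:R.
Proof.
rewrite -(sum_occ s) [RHS](reindex_inj (addIr v)) //.
Qed.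

End Occupancy.

(** * Uniform configurations are well spread *)

Section Spread.
Context {R : realType} {A : finZmodType} (m : nat).
Implicit Types (s : seq A) (a b v : A).
Local Notation p := (#|A|%:R : R).
Local Notation L := (ln p).
Local Notation mR := (m%:R : R).
Local Notation occ := (@occ R A).
Local Notation power_sum := (@power_sum R A).
Local Notation autocorr := (@autocorr R A).

Hypothesis L_ge1 : 1 <= L.
Hypothesis m_le_p : mR <= p.
Hypothesis L3_le_m : 122 * L ^+ 3 <= mR.
Hypothesis L2p_le_m2 : 256 * L ^+ 2 * p <= mR ^+ 2.

(** The events [low_occ] and [low_energy] are inherited by tails, so they may
serve as truncations in the supermartingale bounds. *)
Definition low_occ s := [forall a, occ s a <= 4 * L].

Definition low_energy s := low_occ s && (power_sum 2 s <= 7 * mR).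

Lemma p_gt0 : 0 < p.
Proof. by rewrite ltr0n; apply/card_gt0P; exists 0. Qed.

Lemma expRNL : expR (- L) = p^-1.
Proof. by rewrite expRN lnK // posrE p_gt0. Qed.

Lemma expRN2L : expR (- (2 * L)) = p^-1 ^+ 2.
Proof. by rewrite -expRNL expr2 -expRD; congr expR; ring. Qed.

Lemma low_occ_behead a s : low_occ (a :: s) -> low_occ s.
Proof.
move=> /forallP h; apply/forallP => b; apply: le_trans (h b).
by rewrite occ_cons lerDr ler0n.
Qed.

Lemma low_energy_behead a s : low_energy (a :: s) -> low_energy s.
Proof.
move=> /andP[/low_occ_behead h1 h]; rewrite /low_energy h1 /=.
apply: le_trans h; rewrite -subr_ge0 power_sum_cons; have := @occ_ge0 R A s a; nra.
Qed.

Local Notation count_tuples Q := (#|[pred t : m.-tuple A | Q t]|%:R : R).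

(** A cell receives each ball with probability [1 / p], so its count has an
exponential moment bounded by [expR 1], and exceeds [4 L] with probability
[O(p^-2)]. *)
Lemma high_occ_rare : count_tuples (fun t => ~~ low_occ t) <= p ^+ m * (4 / p).
Proof.
have one a : count_tuples (fun t => 4 * L <= occ t a) <= p ^+ m * (4 / p ^+ 2).
  have := @upper_tail R A (fun s => occ s a) predT m 2^-1 p^-1 (4 * L).
  move=> /(_ _ _ _ _ _ _)/le_trans; apply => //=.
  - by move=> s b _ _; rewrite occ_cons addrK ler0n.
  - move=> s b _ _; rewrite occ_cons addrK; case: (b == a) => /=; lra.
  - move=> s _ _; under eq_bigr do rewrite occ_cons addrK.
    rewrite mulfV ?gt_eqF ?p_gt0 // (bigD1 a) //= eqxx big1 ?addr0 //.
    by move=> i /negbTE ->.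
  apply: ler_wpM2l; first by rewrite exprn_ge0 // ltW // p_gt0.
  apply: (@le_trans _ _ (expR (1 + - (2 * L)))).
    rewrite ler_expR.
    have : p^-1 * mR <= 1 by rewrite ler_pdivrMl ?mulr1 // p_gt0.
    lra.
  rewrite expRD expRN2L exprVn; apply: ler_wpM2r; last exact: expR1_le4.
  by rewrite invr_ge0 exprn_ge0 // ltW // p_gt0.
apply: (@le_trans _ _ (\sum_a count_tuples (fun t => 4 * L <= occ t a))).
  rewrite -natr_sum ler_nat.
  apply: leq_trans (@card_exists_le _ _ (fun a (t : m.-tuple A) => 4 * L <= occ t a)).
  apply/subset_leq_card/fintype.subsetP => t; rewrite !inE => /forallPn[a ha].
  by apply/existsP; exists a; rewrite ltW // ltNge.
apply: (le_trans (ler_sum _ (fun a _ => one a))).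
rewrite sumr_const -mulr_natl le_eqVlt; apply/orP; left; apply/eqP.
by field; rewrite gt_eqF // p_gt0.
Qed.

Lemma size_le s : (size s < m)%N -> (size s)%:R <= mR.
Proof. by move=> h; rewrite ler_nat ltnW. Qed.

(** A ball added to a cell of count [N] increases the energy by [2 N + 1]: at most
[9 L] on [low_occ], and at most [3] on average since [m <= p]. *)
Lemma high_energy_rare :
  count_tuples (fun t => low_occ t && (7 * mR <= power_sum 2 t)) <= p ^+ m / p.
Proof.
have Lm := L3_le_m; have L1 := L_ge1; have mp := m_le_p.
have L0 : 0 < L by apply: lt_le_trans L1.
have p0 := p_gt0.
have := @upper_tail R A (power_sum 2) low_occ m (18 * L)^-1 3 (7 * mR).
move=> /(_ _ _ low_occ_behead _ _ _)/le_trans; apply.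
- by rewrite invr_ge0; lra.
- exact: power_sum_nil.
- by move=> s b _ _; rewrite power_sum_cons; have := @occ_ge0 R A s b; nra.
- move=> s b _ /forallP/(_ b) h; rewrite power_sum_cons ler_pdivrMl; last lra.
  rewrite (_ : _ - _ = 2 * occ s b + 1); last by ring.
  lra.
- move=> s /size_le hs _; under eq_bigr do rewrite power_sum_cons.
  rewrite (eq_bigr (fun b => 2 * occ s b + 1)); last by move=> b _; ring.
  by rewrite big_split /= -mulr_sumr sum_occ sumr_const; lra.
apply: ler_wpM2l; first by rewrite exprn_ge0 // ltW.
rewrite -expRNL ler_expR ler_pdivrMl; last lra.
have : 0 <= L * (L - 1) by apply: mulr_ge0; lra.
have : 0 <= L ^+ 2 * (L - 1) by apply: mulr_ge0; [rewrite exprn_ge0 // ltW|lra].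
lra.
Qed.

(** The increment [3 N^2 + 3 N + 1] has conditional mean [O(1)] precisely because
the energy is [O(m)] so far; it is at most [61 L^2] on [low_occ]. *)
Lemma high_cubes_rare :
  count_tuples (fun t => low_energy t && (51 * mR <= power_sum 3 t)) <= p ^+ m / p.
Proof.
have Lm := L3_le_m; have L1 := L_ge1; have mp := m_le_p.
have L0 : 0 < L by apply: lt_le_trans L1.
have p0 := p_gt0.
have LL : L <= L ^+ 2 by rewrite expr2; nra.
have := @upper_tail R A (power_sum 3) low_energy m (122 * L ^+ 2)^-1 25 (51 * mR).
move=> /(_ _ _ low_energy_behead _ _ _)/le_trans; apply.
- by rewrite invr_ge0; lra.
- exact: power_sum_nil.
- by move=> s b _ _; rewrite power_sum_cons; have := @occ_ge0 R A s b; nra.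
- move=> s b _ /andP[/forallP/(_ b) h _]; rewrite power_sum_cons ler_pdivrMl; last lra.
  have h0 := @occ_ge0 R A s b.
  have : occ s b ^+ 2 <= 16 * L ^+ 2 by nra.
  rewrite (_ : _ - _ = 3 * occ s b ^+ 2 + 3 * occ s b + 1); last by ring.
  lra.
- move=> s /size_le hs /andP[_ h]; under eq_bigr do rewrite power_sum_cons.
  rewrite (eq_bigr (fun b => 3 * occ s b ^+ 2 + 3 * occ s b + 1)); last by move=> b _; ring.
  move: h; rewrite /power_sum => h.
  by rewrite !big_split /= -!mulr_sumr sum_occ sumr_const; lra.
apply: ler_wpM2l; first by rewrite exprn_ge0 // ltW.
rewrite -expRNL ler_expR ler_pdivrMl; last lra.
have : L ^+ 3 = L ^+ 2 * L by ring.
lra.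
Qed.

Lemma sum_nat_half n : \sum_(j < n) (j%:R : R) = n%:R * (n%:R - 1) / 2.
Proof.
elim: n => [|n IH]; first by rewrite big_ord0 mul0r mul0r.
by rewrite big_ord_recr /= IH -natr1; field.
Qed.

(** On [low_occ] an increment is at most [8 L], and its conditional mean is at
most [2 m / p].  The exponent obtained is [m^2 / (16 L p)], which the condition
on [m] makes larger than [2 L]. *)
Lemma high_autocorr_rare v : v != 0 ->
  count_tuples (fun t => low_occ t && (5 * mR ^+ 2 / p <= autocorr v t))
    <= p ^+ m / p ^+ 2.
Proof.
move=> v0.
have Lm := L2p_le_m2; have L1 := L_ge1; have mp := m_le_p.
have L0 : 0 < L by apply: lt_le_trans L1.
have p0 := p_gt0.
have := @upper_tail R A (autocorr v) low_occ m (16 * L)^-1 (2 * mR / p) (5 * mR ^+ 2 / p).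
move=> /(_ _ _ low_occ_behead _ _ _)/le_trans; apply.
- by rewrite invr_ge0; lra.
- exact: autocorr_nil.
- by move=> s b _ _; rewrite autocorr_cons // addr_ge0 ?occ_ge0.
- move=> s b _ /forallP h; rewrite autocorr_cons // ler_pdivrMl; last lra.
  have := h (b + v); have := h (b - v); lra.
- move=> s /size_le hs _; under eq_bigr do rewrite autocorr_cons //.
  rewrite big_split /= !sum_occ_shift mulrC divfK ?gt_eqF //; lra.
apply: ler_wpM2l; first by rewrite exprn_ge0 // ltW.
rewrite -exprVn -expRN2L ler_expR ler_pdivrMl; last lra.
have -> : 2 * (2 * mR / p) * mR - 5 * mR ^+ 2 / p = - (mR ^+ 2 / p) by ring.
have : 256 * L ^+ 2 <= mR ^+ 2 / p by rewrite ler_pdivlMr.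
have : 0 <= L ^+ 2 by rewrite exprn_ge0 // ltW.
rewrite expr2; lra.
Qed.

(** The [j]-th increment has conditional mean exactly [2 j / p]; these add up to
about [m^2 / p], of which at least an eighth is present. *)
Lemma low_autocorr_rare v : v != 0 ->
  count_tuples (fun t => low_occ t && (autocorr v t <= mR ^+ 2 / (8 * p)))
    <= p ^+ m / p ^+ 2.
Proof.
move=> v0.
have Lm3 := L3_le_m; have Lm := L2p_le_m2; have L1 := L_ge1; have mp := m_le_p.
have L0 : 0 < L by apply: lt_le_trans L1.
have p0 := p_gt0.
have := @lower_tail R A (autocorr v) low_occ (fun j => 2 * j%:R / p) m
  (16 * L)^-1 (mR ^+ 2 / (8 * p)).
move=> /(_ _ _ low_occ_behead _ _ _)/le_trans; apply.
- by rewrite invr_gt0; lra.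
- exact: autocorr_nil.
- by move=> s b _ _; rewrite autocorr_cons // addr_ge0 ?occ_ge0.
- move=> s b _ /forallP h; rewrite autocorr_cons // ler_pdivrMl; last lra.
  have := h (b + v); have := h (b - v); lra.
- move=> s /size_le hs _; under eq_bigr do rewrite autocorr_cons //.
  rewrite big_split /= !sum_occ_shift mulrC divfK ?gt_eqF //; lra.
apply: ler_wpM2l; first by rewrite exprn_ge0 // ltW.
rewrite -exprVn -expRN2L ler_expR ler_pdivrMl; last lra.
rewrite -mulr_suml -mulr_sumr sum_nat_half.
have h1 : 256 * L ^+ 2 <= mR ^+ 2 / p by rewrite ler_pdivlMr.
have h2 : 0 <= L ^+ 2 by rewrite exprn_ge0 // ltW.
have h3 : 2 * mR <= mR ^+ 2.
  suff : 2 <= mR by nra.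
  have : 1 <= L ^+ 3 by exact: exprn_ege1.
  lra.
have h4 : 2 * mR / p <= mR ^+ 2 / p by rewrite ler_pM2r ?invr_gt0.
have -> : mR ^+ 2 / (8 * p) - 2 * (mR * (mR - 1) / 2) / p / 2
  = - (3 / 8) * (mR ^+ 2 / p) + 4^-1 * (2 * mR / p) by field; rewrite gt_eqF.
rewrite (_ : 16 * L * _ = - 32 * L ^+ 2); last by ring.
lra.
Qed.

Definition well_spread s :=
  [&& low_occ s, power_sum 3 s <= 51 * mR &
   [forall v, (v != 0) ==>
      (mR ^+ 2 / (8 * p) <= autocorr v s <= 5 * mR ^+ 2 / p)]].

(** The four kinds of failure cost [4 / p], [1 / p], [1 / p] and [2 / p]: the
last one is a union over the [p] values of [v] and over two tails. *)
Lemma well_spread_likely :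
  count_tuples (fun t => ~~ well_spread t) <= p ^+ m * (8 / p).
Proof.
have p0 := p_gt0.
pose B1 (t : m.-tuple A) := ~~ low_occ t.
pose B2 (t : m.-tuple A) := low_occ t && (7 * mR <= power_sum 2 t).
pose B3 (t : m.-tuple A) := low_energy t && (51 * mR <= power_sum 3 t).
pose B4 v (t : m.-tuple A) :=
  (v != 0) && (low_occ t && (5 * mR ^+ 2 / p <= autocorr v t)).
pose B5 v (t : m.-tuple A) :=
  (v != 0) && (low_occ t && (autocorr v t <= mR ^+ 2 / (8 * p))).
(* Each bound is only known to fail rarely inside an earlier event, so the first
   one that fails is selected. *)
have cov (t : m.-tuple A) : ~~ well_spread t ->
    [|| B1 t, B2 t, B3 t, [exists v, B4 v t] | [exists v, B5 v t]].
  rewrite /B1; case: (boolP (low_occ t)) => //= h1.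
  rewrite /well_spread h1 /= negb_and => /orP[]; rewrite /B2 /B3 /low_energy.
    rewrite -ltNge => /ltW ->; rewrite h1 andbT /=.
    by case: (leP (power_sum 2 t) (7 * mR)) => [_|/ltW ->]; rewrite ?orbT.
  move=> /forallPn[v]; rewrite negb_imply negb_and -!ltNge => /andP[v0].
  by case/orP => /ltW h; apply/or4P; [apply: Or44|apply: Or43];
     apply/existsP; exists v; rewrite /B4 /B5 v0 h1.
have bnd4 : (\sum_v #|B4 v|)%:R <= p ^+ m / p.
  rewrite natr_sum; apply: (@le_trans _ _ (\sum_(v : A) p ^+ m / p ^+ 2)).
    apply: ler_sum => v _; have [->|v0] := eqVneq v 0.
      rewrite (eq_card0 (A := B4 0)) ?divr_ge0 ?exprn_ge0 //.
      by move=> t; rewrite /in_mem /= /B4 eqxx.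
    apply: le_trans (high_autocorr_rare v0).
    rewrite ler_nat; apply/subset_leq_card/fintype.subsetP => t.
    by rewrite !inE /in_mem /= /B4 v0.
  rewrite sumr_const -mulr_natl le_eqVlt; apply/orP; left; apply/eqP.
  by field; rewrite gt_eqF.
have bnd5 : (\sum_v #|B5 v|)%:R <= p ^+ m / p.
  rewrite natr_sum; apply: (@le_trans _ _ (\sum_(v : A) p ^+ m / p ^+ 2)).
    apply: ler_sum => v _; have [->|v0] := eqVneq v 0.
      rewrite (eq_card0 (A := B5 0)) ?divr_ge0 ?exprn_ge0 //.
      by move=> t; rewrite /in_mem /= /B5 eqxx.
    apply: le_trans (low_autocorr_rare v0).
    rewrite ler_nat; apply/subset_leq_card/fintype.subsetP => t.
    by rewrite !inE /in_mem /= /B5 v0.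
  rewrite sumr_const -mulr_natl le_eqVlt; apply/orP; left; apply/eqP.
  by field; rewrite gt_eqF.
have -> : p ^+ m * (8 / p) = p ^+ m * (4 / p) + (p ^+ m / p +
   (p ^+ m / p + (p ^+ m / p + p ^+ m / p))) by ring.
apply: le_trans (lerD high_occ_rare (lerD high_energy_rare
  (lerD high_cubes_rare (lerD bnd4 bnd5)))).
rewrite -!natrD ler_nat.
apply: leq_trans (leq_add (leqnn _) (leq_add (leqnn _) (leq_add (leqnn _)
  (leq_add (card_exists_le B4) (card_exists_le B5))))).
apply: leq_trans (leq_add (leqnn _) (leq_trans (card_or_le _ _) (leq_add (leqnn _)
  (leq_trans (card_or_le _ _) (leq_add (leqnn _) (card_or_le _ _)))))).
apply: leq_trans (card_or_le _ _).
apply/subset_leq_card/fintype.subsetP => t; exact: cov.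
Qed.

End Spread.

(** * Chernoff bounds for truncated Poisson sums *)

Section PoissonChernoff.
Context {R : realType}.

(** At rate [0] this is the Dirac mass at [0]; [poisson_massE] covers that case
too, since [0 ^+ 0 = 1]. *)
Definition poisson_mass (r : R) (j : nat) : R := fine (poisson_prob r 0%N [set j]).

Lemma poisson_massE (r : R) j : 0 <= r ->
  poisson_mass r j = expR (- r) * (r ^+ j / j`!%:R).
Proof.
rewrite le_eqVlt /poisson_mass /poisson_prob => /predU1P[<-|r0].
  rewrite ltxx oppr0 expR0 mul1r expr0n diracE.
  rewrite classical_sets.in_set1. by case: j => [|j]; rewrite /= ?divr1 ?mul0r.  
rewrite r0 esum_set1 /= ?lee_fin ?poisson_pmf_ge0 //.
by rewrite /poisson_pmf r0 mulrC.
Qed.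

Lemma poisson_mass_ge0 (r : R) j : 0 <= poisson_mass r j.
Proof. by rewrite /poisson_mass fine_ge0. Qed.

Lemma exp_coeff_sum_le (x : R) K : 0 <= x -> \sum_(j < K) x ^+ j / j`!%:R <= expR x.
Proof.
move=> x0; rewrite /expR.
have := @nondecreasing_cvgn_le R (series (exp_coeff x)) _ _ K.
rewrite /series /= big_mkord; apply; last exact: is_cvg_series_exp_coeff.
apply/nondecreasing_seqP => n; rewrite /= big_nat_recr //= lerDl.
exact: exp_coeff_ge0.
Qed.

(** Truncating the values at [K] keeps a partial sum of an exponential series,
hence only decreases the moment generating function. *)
Lemma poisson_mgf_le (r a : R) K : 0 <= r ->
  \sum_(j < K) expR (a * j%:R) * poisson_mass r j <= expR (r * (expR a - 1)).
Proof.
move=> r0.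
rewrite (eq_bigr (fun j : 'I_K => expR (- r) * ((r * expR a) ^+ j / j`!%:R))).
  rewrite -mulr_sumr mulrBr mulr1 [r * _ - _]addrC expRD ler_pM2l ?expR_gt0 //.
  by apply: exp_coeff_sum_le; rewrite mulr_ge0 // expR_ge0.
move=> j _; rewrite poisson_massE // exprMn -expRM_natr; ring.
Qed.

Context {I : finType} (r V : I -> R) (K : nat).
Hypothesis r_ge0 : forall i, 0 <= r i.
Implicit Type y : {ffun I -> 'I_K}.

Let dot y : R := \sum_i V i * (y i)%:R.
Let mean : R := \sum_i V i * r i.

(** Under a product of (truncated) Poisson laws, the exponential moment of a
linear form factorizes; distributing the product over the finite sums is the
only form of independence used. *)
Lemma poisson_exp_tail (a tau : R) :
  \sum_(y : {ffun I -> 'I_K} | tau <= a * dot y) \prod_i poisson_mass (r i) (y i)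
    <= expR (\sum_i r i * (expR (a * V i) - 1) - tau).
Proof.
rewrite expRD expR_sum.
have prod_ge0 y : 0 <= \prod_i poisson_mass (r i) (y i).
  by apply: prodr_ge0 => i _; exact: poisson_mass_ge0.
apply: (@le_trans _ _ (\sum_(y : {ffun I -> 'I_K})
   (\prod_i (expR (a * V i * (y i)%:R) * poisson_mass (r i) (y i))) * expR (- tau))).
  rewrite big_mkcond /=; apply: ler_sum => y _.
  rewrite big_split /= -expR_sum mulrAC -expRD.
  case: ifP => [h|_]; last by rewrite mulr_ge0 ?expR_ge0.
  rewrite -[leLHS]mul1r; apply: ler_wpM2r => //; rewrite -[leLHS]expR0 ler_expR.
  rewrite (_ : \sum_i _ = a * dot y) ?subr_ge0 //.
  by rewrite /dot mulr_sumr; apply: eq_bigr => i _; rewrite mulrA.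
rewrite -mulr_suml ler_wpM2r ?expR_ge0 //.
rewrite -(bigA_distr_bigA (fun i (j : 'I_K) =>
  expR (a * V i * j%:R) * poisson_mass (r i) j)).
apply: ler_prod => i _; rewrite poisson_mgf_le // andbT.
by apply: sumr_ge0 => j _; rewrite mulr_ge0 ?expR_ge0 ?poisson_mass_ge0.
Qed.

Variable (b : R).
Hypothesis b_gt0 : 0 < b.
Hypothesis V_bound : forall i, 0 <= V i <= b.

(** With exponent [1 / (2 b)], each coefficient contributes at most [1 / 2] to the
exponent, and the deviation [4 * b * l] costs [expR (- (2 * l))]. *)
Lemma poisson_upper_tail (l : R) :
  \sum_(y : {ffun I -> 'I_K} | 2 * mean + 4 * b * l <= dot y)
     \prod_i poisson_mass (r i) (y i) <= expR (- (2 * l)).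
Proof.
pose a := (2 * b)^-1; have a0 : 0 < a by rewrite invr_gt0 mulr_gt0.
have := poisson_exp_tail a (a * (2 * mean + 4 * b * l)).
under eq_bigl do rewrite ler_pM2l //.
move=> h; apply: le_trans h _; rewrite ler_expR.
have -> : - (2 * l) = 2 * a * mean - a * (2 * mean + 4 * b * l).
  by rewrite /a; field; rewrite gt_eqF.
rewrite lerD2r /mean mulr_sumr; apply: ler_sum => i _.
have /andP[V0 Vb] := V_bound i.
have : expR (a * V i) <= 1 + 2 * (a * V i).
  apply: expR_le_1D2x; rewrite mulr_ge0 //=; last exact: ltW.
  by rewrite /a ler_pdivrMl ?mulr_gt0 //; lra.
have := r_ge0 i; nra.
Qed.

Lemma poisson_lower_tail (l : R) :
  \sum_(y : {ffun I -> 'I_K} | dot y <= mean / 2 - 4 * b * l)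
     \prod_i poisson_mass (r i) (y i) <= expR (- (2 * l)).
Proof.
pose a := (2 * b)^-1; have a0 : 0 < a by rewrite invr_gt0 mulr_gt0.
have := poisson_exp_tail (- a) (- a * (mean / 2 - 4 * b * l)).
under eq_bigl do rewrite !mulNr lerN2 ler_pM2l //.
move=> h; apply: le_trans h _; rewrite ler_expR.
have -> : - (2 * l) = - a / 2 * mean - - a * (mean / 2 - 4 * b * l).
  by rewrite /a; field; rewrite gt_eqF.
rewrite lerD2r /mean mulr_sumr; apply: ler_sum => i _.
have /andP[V0 Vb] := V_bound i.
have : expR (- (a * V i)) <= 1 - (a * V i) / 2.
  apply: expRN_le_1Bhalf; rewrite mulr_ge0 //=; last exact: ltW.
  by rewrite /a ler_pdivrMl ?mulr_gt0 //; lra.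
rewrite mulNr; have := r_ge0 i; nra.
Qed.

End PoissonChernoff.

(** * Mean of the statistic for a well-spread configuration *)

Section Weights.
Context {R : realType} {A : finZmodType} (m : nat).
Implicit Types (t : m.-tuple A) (k l v : A) (x : A -> R).
Local Notation p := (#|A|%:R : R).
Local Notation L := (ln p).
Local Notation mR := (m%:R : R).
Local Notation occ := (@occ R A).

Definition weight t k l : R := ((occ t (l - k) - (mR - 1) / p) / mR) ^+ 2.

Definition rate t x l : R := \sum_v occ t (l - v) * x v.

(** The contribution of a unit mass at [v] to the mean of the statistic at [k]. *)
Definition response t k v : R := \sum_l weight t k l * occ t (l - v).

Lemma weight_ge0 t k l : 0 <= weight t k l.
Proof. exact: sqr_ge0. Qed.

Lemma rate_ge0 t x l : (forall v, 0 <= x v) -> 0 <= rate t x l.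
Proof. by move=> x0; apply: sumr_ge0 => v _; rewrite mulr_ge0 ?occ_ge0. Qed.

Lemma sum_weight_rate t x k :
  \sum_l weight t k l * rate t x l =
  x k * response t k k + \sum_(v | v != k) response t k v * x v.
Proof.
transitivity (\sum_v response t k v * x v); last by rewrite (bigD1 k) //= mulrC.
under eq_bigr do rewrite mulr_sumr.
rewrite exchange_big /=; apply: eq_bigr => v _.
by rewrite mulr_suml; apply: eq_bigr => l _; rewrite mulrA.
Qed.

Hypothesis L_ge1 : 1 <= L.
Hypothesis m_ge1 : (0 < m)%N.
Hypothesis m_le_half_p : mR <= p / 2.
Variable t : m.-tuple A.
Hypothesis t_spread : @well_spread R A m t.

Let mu : R := (mR - 1) / p.

Lemma mR_ge1 : 1 <= mR. Proof. by rewrite ler1n. Qed.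

Lemma mu_bounds : 0 <= mu <= 2^-1.
Proof.
have m1 := mR_ge1; have p0 := @p_gt0 R A; have mp := m_le_half_p.
rewrite /mu divr_ge0 ?ler_pdivrMr //=; lra.
Qed.

Lemma occ_eq0_or_ge1 a : occ t a = 0 \/ 1 <= occ t a.
Proof.
rewrite /occ; case: (count_mem a t) => [|n]; first by left.
by right; rewrite ler1n.
Qed.

(** Counts are integers: an empty cell satisfies this trivially, and a nonempty
one has count at least [1], at least twice the centering. *)
Lemma sqr_dev_ge a : occ t a / 4 <= (occ t a - mu) ^+ 2.
Proof.
have /andP[mu0 mu1] := mu_bounds; rewrite /mu in mu0 mu1 *.
case: (occ_eq0_or_ge1 a) => [->|h]; first by rewrite mul0r sqr_ge0.
have : 0 <= (occ t a - 1) * (occ t a - 4^-1) by apply: mulr_ge0; lra.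
have : 0 <= (2^-1 - (mR - 1) / p) * (2 * occ t a - (mR - 1) / p - 2^-1).
  by apply: mulr_ge0; lra.
lra.
Qed.

Lemma sqr_dev_le a : (occ t a - mu) ^+ 2 <= occ t a ^+ 2 + mu ^+ 2.
Proof.
have /andP[mu0 mu1] := mu_bounds; have h := @occ_ge0 R A t a.
have := mulr_ge0 h mu0; lra.
Qed.

Lemma responseE k v :
  response t k v =
  (\sum_a (occ t a - mu) ^+ 2 * occ t (a + (k - v))) / mR ^+ 2.
Proof.
rewrite /response (reindex_inj (addIr k)) mulr_suml /=.
by apply: eq_bigr => a _; rewrite /weight addrK addrA expr_div_n mulrAC.
Qed.

Lemma sum_occ_tuple : \sum_a occ t a = mR.
Proof. by rewrite sum_occ size_tuple. Qed.

Lemma response_diag_ge k : (4 * mR)^-1 <= response t k k.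
Proof.
have m1 := mR_ge1.
rewrite responseE subrr (_ : (4 * mR)^-1 = (mR / 4) / mR ^+ 2); last first.
  by field; rewrite gt_eqF //; lra.
rewrite ler_pM2r ?invr_gt0 ?exprn_gt0 //; last lra.
rewrite -{1}sum_occ_tuple mulr_suml; apply: ler_sum => a _; rewrite addr0.
case: (occ_eq0_or_ge1 a) => [->|h]; first by rewrite mul0r mulr0.
have := sqr_dev_ge a; have := sqr_ge0 (occ t a - mu); nra.
Qed.

(** Here the weight, quadratic in the count, is multiplied by the count itself:
the sum of cubes appears. *)
Lemma response_diag_le k : response t k k <= 52 / mR.
Proof.
have m1 := mR_ge1; have /andP[mu0 mu1] := mu_bounds.
have /and3P[_ S3 _] := t_spread.
rewrite responseE subrr (_ : 52 / mR = (51 * mR + mR) / mR ^+ 2); last first.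
  by field; rewrite gt_eqF //; lra.
rewrite ler_pM2r ?invr_gt0 ?exprn_gt0 //; last lra.
apply: le_trans (lerD S3 (lexx _)).
rewrite -[in leRHS]sum_occ_tuple -big_split /=; apply: ler_sum => a _.
rewrite addr0; have := sqr_dev_le a; have := @occ_ge0 R A t a => h0 h1.
have h2 : mu ^+ 2 <= 1 by nra.
have := ler_wpM2r h0 h1; have := ler_wpM2r h0 h2.
rewrite mulrDl -exprSr; lra.
Qed.

Lemma autocorr_bounds k v : v != k ->
  mR ^+ 2 / (8 * p) <= @autocorr R A (k - v) t <= 5 * mR ^+ 2 / p.
Proof.
have /and3P[_ _ /forallP/(_ (k - v))/implyP h] := t_spread.
by move=> vk; apply: h; rewrite subr_eq0 eq_sym.
Qed.

(** By [sqr_dev_ge] the weight dominates the count, so the response dominates an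
autocorrelation. *)
Lemma response_off_ge k v : v != k -> (32 * p)^-1 <= response t k v.
Proof.
move=> /autocorr_bounds/andP[h _]; have m1 := mR_ge1; have p0 := @p_gt0 R A.
rewrite responseE ler_pdivlMr ?exprn_gt0 //; last lra.
have -> : (32 * p)^-1 * mR ^+ 2 = 4^-1 * (mR ^+ 2 / (8 * p)).
  by field; rewrite gt_eqF.
apply: (@le_trans _ _ (4^-1 * @autocorr R A (k - v) t)); first by rewrite ler_pM2l.
rewrite mulr_sumr; apply: ler_sum => a _; rewrite mulrA mulrC.
rewrite [leRHS]mulrC; apply: ler_wpM2l; first exact: occ_ge0.
by rewrite mulrC sqr_dev_ge.
Qed.

(** One factor of the squared count is bounded by [4 * L], leaving an
autocorrelation: this is where the upper bound loses a logarithm over the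
lower one. *)
Lemma response_off_le k v : v != k -> response t k v <= 21 * L / p.
Proof.
move=> /autocorr_bounds/andP[_ h]; have m1 := mR_ge1; have p0 := @p_gt0 R A.
have L1 := L_ge1; have mp := m_le_half_p.
have /and3P[/forallP lo _ _] := t_spread.
rewrite responseE ler_pdivrMr ?exprn_gt0 //; last lra.
have -> : 21 * L / p * mR ^+ 2 =
  4 * L * (5 * mR ^+ 2 / p) + L * (mR ^+ 2 / p) by field; rewrite gt_eqF.
apply: (@le_trans _ _ (4 * L * @autocorr R A (k - v) t + mu ^+ 2 * mR)).
  rewrite -(_ : \sum_a occ t (a + (k - v)) = mR); last first.
    by rewrite sum_occ_shift size_tuple.
  rewrite !mulr_sumr -big_split /=; apply: ler_sum => a _.
  have := sqr_dev_le a; have := @occ_ge0 R A t a; have := lo a.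
  have := @occ_ge0 R A t (a + (k - v)) => h0 h1 h2 h3.
  apply: (le_trans (ler_wpM2r h0 h3)); rewrite mulrDl lerD2r expr2 mulrA.
  by apply: ler_wpM2r => //; apply: ler_wpM2r.
apply: lerD; first by rewrite ler_pM2l //; lra.
have q0 : 0 <= mR ^+ 2 / p by rewrite divr_ge0 ?exprn_ge0 // ltW.
apply: (@le_trans _ _ (mR ^+ 2 / p)); last by rewrite ler_peMl.
have -> : mR ^+ 2 / p = (mR / p * mR) by ring.
apply: ler_wpM2r; first lra.
have h1 : mu <= mR / p by rewrite ler_pM2r ?invr_gt0 //; lra.
by have /andP[mu0 mu1] := mu_bounds; nra.
Qed.

Lemma mean_ge x k : (forall v, 0 <= x v) ->
  x k / (4 * mR) + (\sum_(v | v != k) x v) / (32 * p)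
    <= \sum_l weight t k l * rate t x l.
Proof.
move=> x0; rewrite sum_weight_rate; apply: lerD.
  by apply: ler_wpM2l => //; exact: response_diag_ge.
rewrite mulr_suml; apply: ler_sum => v vk; rewrite mulrC.
by apply: ler_wpM2r => //; exact: response_off_ge.
Qed.

Lemma mean_le x k : (forall v, 0 <= x v) ->
  \sum_l weight t k l * rate t x l
    <= 52 * x k / mR + 21 * L / p * (\sum_(v | v != k) x v).
Proof.
move=> x0; rewrite sum_weight_rate; apply: lerD.
  rewrite mulrAC mulrC; apply: ler_wpM2r => //; exact: response_diag_le.
rewrite mulr_sumr; apply: ler_sum => v vk.
by apply: ler_wpM2r => //; exact: response_off_le.
Qed.

End Weights.

(** * Size of the threshold *)

Section ThresholdAlgebra.
Context {R : realType}.

(** In terms of [a = sqrt L] and [e = sqrt (D + 5 B^2 L / 3)] the threshold is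
[2 a e + 8 / 3 * B a^2], a sum of two nonnegative terms: its square is at
least the sum, and at most twice the sum, of their squares. *)
Lemma threshold_sqr_bounds (B L D : R) : 0 <= B -> 0 <= L -> 0 <= D ->
  let d := Num.sqrt (4 * L) *
    (Num.sqrt (D + 5 * B ^+ 2 * L / 3) + Num.sqrt (B ^+ 2 * L)) + 2 * B * L / 3 in
  4 * L * D + 4 * (B * L) ^+ 2 <= d ^+ 2 /\ d ^+ 2 <= 8 * L * D + 28 * (B * L) ^+ 2.
Proof.
move=> B0 L0 D0.
rewrite (@sqrtrM _ 4) // (@sqrtrM _ (B ^+ 2)) ?exprn_ge0 // sqrtr_sqr ger0_norm //.
have -> : Num.sqrt 4 = 2 :> R.
  by rewrite (_ : 4 = 2 ^+ 2) ?sqrtr_sqr ?ger0_norm //; lra.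
have E0 : 0 <= D + 5 * B ^+ 2 * L / 3.
  by rewrite addr_ge0 // divr_ge0 // !mulr_ge0 ?exprn_ge0.
set e := Num.sqrt (D + _).
have e0 : 0 <= e by exact: sqrtr_ge0.
have eD : e ^+ 2 = D + 5 * B ^+ 2 * L / 3 by rewrite sqr_sqrtr.
set a := Num.sqrt L.
have a0 : 0 <= a by exact: sqrtr_ge0.
have aL : L = a ^+ 2 by rewrite sqr_sqrtr.
move=> d; have dE : d = 2 * (a * e) + 8 / 3 * (B * a ^+ 2).
  by rewrite /d aL; field.
have DE : D = e ^+ 2 - 5 / 3 * B ^+ 2 * a ^+ 2 by rewrite eD -aL; field.
rewrite dE DE aL.
have z0 : 0 <= B * a ^+ 2 by rewrite mulr_ge0 // exprn_ge0.
have w0 : 0 <= a * e by rewrite mulr_ge0.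
have zw := mulr_ge0 z0 w0.
have zz := sqr_ge0 (B * a ^+ 2).
have dd := sqr_ge0 (2 * (a * e) - 8 / 3 * (B * a ^+ 2)).
split; lra.
Qed.

(** In the lower bound, an eighth of [4 L D] is traded for [L M / 4] at the price
of [2 B^2 L^2], half of the available [4 B^2 L^2]. *)
Lemma threshold_bounds (B L D M m p xk S : R) :
  1 <= L -> 1 <= m -> 0 < p -> 0 <= xk -> 0 <= S -> 0 <= D ->
  (2 * m)^-1 <= B -> B <= 4 * L / m ->
  xk / (4 * m) + S / (32 * p) <= M -> M <= 52 * xk / m + 21 * L / p * S ->
  M / 2 - 4 * B ^+ 2 * L <= D -> D <= 2 * M + 4 * B ^+ 2 * L ->
  let d := Num.sqrt (4 * L) *
    (Num.sqrt (D + 5 * B ^+ 2 * L / 3) + Num.sqrt (B ^+ 2 * L)) + 2 * B * L / 3 in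
  256^-1 * (xk * L / m + L / p * S + L ^+ 2 / m ^+ 2) <= d ^+ 2 /\
  d ^+ 2 <= 1000 * (xk * L / m + L ^+ 2 / p * S + L ^+ 4 / m ^+ 2).
Proof.
move=> L1 m1 p0 xk0 S0 D0 Bge Ble Mge Mle Dge Dle d.
have L0 : 0 <= L by lra.
have m0 : 0 < m by lra.
have B0 : 0 <= B by apply: le_trans Bge; rewrite invr_ge0; lra.
have [lo up] := threshold_sqr_bounds B0 L0 D0; rewrite -/d in lo up.
have iX : 0 <= xk * L / m by rewrite !mulr_ge0 // invr_ge0 ltW.
have iS : 0 <= L / p * S by rewrite !mulr_ge0 // invr_ge0 ltW.
have iS2 : L ^+ 2 / p * S = L * (L / p * S) by ring.
have iB : L ^+ 2 / m ^+ 2 = (L / m) ^+ 2 by rewrite expr_div_n.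
have im : 0 <= L / m by rewrite divr_ge0 // ltW.
have BLge : L / m / 2 <= B * L.
  by rewrite (_ : L / m / 2 = (2 * m)^-1 * L) ?ler_wpM2r //; field; rewrite gt_eqF.
have BLle : B * L <= 4 * (L ^+ 2 / m).
  by rewrite (_ : 4 * _ = (4 * L / m) * L) ?ler_wpM2r //; field; rewrite gt_eqF.
have BL2ge : (L / m) ^+ 2 / 4 <= (B * L) ^+ 2 by nra.
have BL2le : (B * L) ^+ 2 <= 16 * (L ^+ 4 / m ^+ 2).
  have -> : 16 * (L ^+ 4 / m ^+ 2) = (4 * (L ^+ 2 / m)) ^+ 2.
    by field; rewrite gt_eqF.
  by rewrite ler_sqr ?nnegrE ?mulr_ge0 ?exprn_ge0 // invr_ge0 ltW.
have BL2 : B ^+ 2 * L * L = (B * L) ^+ 2 by ring.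
have LMge : (xk * L / m) / 4 + (L / p * S) / 32 <= L * M.
  have := ler_wpM2l L0 Mge; apply: le_trans.
  rewrite le_eqVlt; apply/orP; left; apply/eqP; field.
  by rewrite !gt_eqF.
have LMle : L * M <= 52 * (xk * L / m) + 21 * (L ^+ 2 / p * S).
  have := ler_wpM2l L0 Mle => h; apply: (le_trans h).
  rewrite le_eqVlt; apply/orP; left; apply/eqP; field.
  by rewrite !gt_eqF.
have LDge := ler_wpM2l L0 Dge.
have LDle := ler_wpM2l L0 Dle.
have LD0 := mulr_ge0 L0 D0.
have iS3 : 0 <= L ^+ 2 / p * S.
  by rewrite iS2 mulr_ge0.
have iL4 : 0 <= L ^+ 4 / m ^+ 2 by rewrite divr_ge0 ?exprn_ge0 // ltW.
split.
  rewrite iB; lra.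
apply: (le_trans up); lra.
Qed.

End ThresholdAlgebra.

(** * The model at a fixed configuration *)

Section Realization.
Context {R : realType} (q m : nat).
Local Notation p := q.+1.
Implicit Types (t : m.-tuple 'I_p) (k l v : 'I_p).

Definition reading t (i : 'I_m) : nat := tnth t i.

Lemma count_mod_reading t (z : int) (a : 'I_p) : (a%:Z = z %[mod p%:Z])%Z ->
  count_mod p (reading t) z = count_mem a t.
Proof.
move=> az; rewrite /count_mod -!sum1_count big_tuple -sum1_card.
apply: eq_bigl => i; rewrite inE /= -az /reading !modz_nat.
by rewrite !modn_small // eqz_nat val_eqE.
Qed.

Lemma count_mod_sub t k l :
  count_mod p (reading t) (l%:Z - k%:Z) = count_mem (l - k) t.
Proof.
apply: count_mod_reading; rewrite /= modnDmr modz_nat modn_mod -modz_nat PoszD.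
rewrite -subzn; last by rewrite ltnW.
by rewrite addrC -addrA modzDl addrC.
Qed.

Lemma VweightE t k l : Vweight (reading t) k l = weight t k l :> R.
Proof. by rewrite /Vweight /weight count_mod_sub card_ord. Qed.

Lemma conv_mxE t (x : 'cV[R]_p) l :
  (conv_mx R (reading t) *m x) l 0 = rate t (fun v => x v 0) l.
Proof.
rewrite mxE; apply: eq_bigr => v _; rewrite mxE count_mod_sub //.
Qed.

Local Notation L := (ln (p%:R : R)).
Local Notation mR := (m%:R : R).

Lemma BmaxE t : Bmax p (reading t) =
  \big[Num.max/0]_(v : 'I_p) (mR^-1 * `|occ t v - (mR - 1) / p%:R|) :> R.
Proof. by apply: eq_bigr => v _; rewrite (@count_mod_reading _ _ v). Qed.

Lemma dev_le_Bmax t v :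
  mR^-1 * `|occ t v - (mR - 1) / p%:R| <= Bmax p (reading t).
Proof.
rewrite BmaxE.
exact: (le_bigmax 0 (fun v => mR^-1 * `|occ t v - (mR - 1) / p%:R|)).
Qed.

Lemma weight_le_sqr_Bmax t k l : weight t k l <= (Bmax p (reading t) : R) ^+ 2.
Proof.
rewrite /weight card_ord -real_normK ?num_real // normrM normfV normr_nat mulrC.
have B0 : 0 <= Bmax p (reading t) :> R by exact: bigmax_ge_id.
by rewrite ler_sqr ?nnegrE ?mulr_ge0 ?invr_ge0 ?dev_le_Bmax.
Qed.

Hypothesis L_ge1 : 1 <= L.
Hypothesis m_ge1 : (0 < m)%N.
Hypothesis m_le_half_p : mR <= p%:R / 2.
Variable t : m.-tuple 'I_p.
Hypothesis t_spread : @well_spread R 'I_p m t.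

(** The cell hit by the first shift has count at least [1], far from a centering
at most [1 / 2]. *)
Lemma Bmax_ge : (2 * mR)^-1 <= Bmax p (reading t).
Proof.
have m0 : 0 < mR by rewrite ltr0n.
pose a := tnth t (Ordinal m_ge1); apply: le_trans (dev_le_Bmax t a).
rewrite invfM mulrC ler_pM2l ?invr_gt0 //.
have a1 : 1 <= occ t a :> R.
  by rewrite ler1n -has_count has_pred1 mem_tnth.
have := @mu_bounds R 'I_p m m_ge1; rewrite card_ord => /(_ m_le_half_p)/andP[].
by move: a1; set u := _ / p%:R; move: (occ t a) u => o u *; rewrite ger0_norm; lra.
Qed.

Lemma Bmax_le : Bmax p (reading t) <= 4 * L / mR.
Proof.
have L1 := L_ge1; have m0 : 0 < mR by rewrite ltr0n.
rewrite BmaxE; apply: bigmax_le => [|a _].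
  by rewrite divr_ge0 ?ltW //; lra.
rewrite [leRHS]mulrC ler_pM2l ?invr_gt0 //.
have /and3P[/forallP/(_ a) lo _ _] := t_spread.
have := @mu_bounds R 'I_p m m_ge1; rewrite card_ord => /(_ m_le_half_p)/andP[].
rewrite card_ord in lo; have := @occ_ge0 R _ t a; rewrite ler_norml; move: lo.
by set u := _ / p%:R; move: (occ t a) u => o u *; lra.
Qed.

(** All the deterministic work on [dweight]: a well-spread configuration together
with a statistic close to its mean gives the two bounds. *)
Lemma dweight_bounds (y : 'I_p -> nat) (x : 'cV[R]_p) k :
  let b := (Bmax p (reading t) : R) ^+ 2 in
  let M := \sum_l weight t k l * rate t (fun v => x v 0) l in
  let D := \sum_l weight t k l * (y l)%:R in
  let S := \sum_(v | v != k) x v 0 in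
  let dk := dweight R (reading t) y k in
  (forall v, 0 <= x v 0) ->
  M / 2 - 4 * b * L <= D -> D <= 2 * M + 4 * b * L ->
  256^-1 * (x k 0 * L / mR + L / p%:R * S + L ^+ 2 / mR ^+ 2) <= dk ^+ 2 /\
  dk ^+ 2 <= 1000 * (x k 0 * L / mR + L ^+ 2 / p%:R * S + L ^+ 4 / mR ^+ 2).
Proof.
move=> b M D S dk x0 Dge Dle.
have D0 : 0 <= D.
  by apply: sumr_ge0 => l _; rewrite mulr_ge0 ?weight_ge0.
have -> : dk = Num.sqrt (4 * L) *
    (Num.sqrt (D + 5 * b * L / 3) + Num.sqrt (b * L)) +
    2 * Bmax p (reading t) * L / 3.
  by rewrite /dk /dweight /Vdot; under eq_bigr do rewrite VweightE.
have S0 : 0 <= S by apply: sumr_ge0.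
have cA : #|'I_p|%:R = p%:R :> R by rewrite card_ord.
have L1 : 1 <= ln (#|'I_p|%:R : R) by rewrite cA.
have mp : mR <= #|'I_p|%:R / 2 by rewrite cA.
have lo := mean_ge m_ge1 mp t_spread k x0.
have up := mean_le L1 m_ge1 mp t_spread k x0.
rewrite cA in lo up.
have m1 : 1 <= mR by rewrite ler1n.
by have := threshold_bounds L_ge1 m1 (ltr0Sn R q) (x0 k) S0 D0 Bmax_ge Bmax_le
  lo up Dge Dle.
Qed.

End Realization.

(** * Atoms of the joint law *)

Lemma in_finite_bigsetU (I : finType) (S : Type) (Q : pred I) (F : I -> set S) w :
  (\big[setU/set0]_(i | Q i) F i) w <-> exists2 i, Q i & F i w.
Proof.
rewrite -bigcup_seq_cond; split.
  by move=> [i /= /andP[_ Qi] Fi]; exists i.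
by move=> [i Qi Fi]; exists i => //=; rewrite mem_index_enum.
Qed.

Section MeasureFacts.
Context {d : measure_display} {T : measurableType d} {R : realType}.
Variable P : probability T R.

Lemma preimage_nat_measurable (X : {RV P >-> nat}) (B : set nat) :
  measurable (X @^-1` B).
Proof. exact: measurable_funPTI. Qed.

Lemma measure_bigsetU_le (I : Type) (r : seq I) (Q : pred I) (F : I -> set T) :
  (forall i, measurable (F i)) ->
  (P (\big[setU/set0]_(i <- r | Q i) F i) <= \sum_(i <- r | Q i) P (F i))%E.
Proof.
move=> mF; elim: r => [|i r IH]; first by rewrite !big_nil measure0.
rewrite !big_cons; case: ifP => // _.
apply: le_trans (measureU2 _ _ _) _ => //; first exact: bigsetU_measurable.
by rewrite leeD2l.
Qed.

Lemma nat_RV_tail (X : {RV P >-> nat}) (e : R) : 0 < e ->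
  exists K, (P (X @^-1` [set j | (K <= j)%N]) <= e%:E)%E.
Proof.
move=> e0.
pose F K := X @^-1` [set j | (K <= j)%N].
have mF K : measurable (F K) by exact: preimage_nat_measurable.
have F0 : \bigcap_K F K = set0.
  rewrite -subset0 => w /(_ (X w).+1 Logic.I) /=; by rewrite /F /= ltnn.
have : (P \o F) K @[K --> \oo] --> 0%E.
  rewrite -[X in _ --> X](measure0 P) -F0; apply: nonincreasing_cvg_mu => //.
  - by rewrite (le_lt_trans (probability_le1 _ _)) ?ltry.
  - by rewrite F0.
  - move=> a b ab; apply/subsetPset => w /=; exact: leq_trans.
move=> /fine_cvg/cvgr_lt/(_ _ e0)[K _ /(_ K (leqnn K)) /=] h.
have fP : P (F K) \is a fin_num by exact: fin_num_measure.
by exists K; rewrite -/(F K) -(fineK fP) lee_fin ltW.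
Qed.

Lemma uniform_below_out (p : nat) (X : {RV P >-> nat}) : (0 < p)%N ->
  uniform_below p X -> P (X @^-1` [set j | (p <= j)%N]) = 0%E.
Proof.
move=> p0 uX.
pose F j := X @^-1` [set j].
have mF j : measurable (F j) by exact: preimage_nat_measurable.
have tF : trivIset setT F.
  by move=> i j _ _ [w [/= <- <-]].
have -> : X @^-1` [set j | (p <= j)%N] = ~` \big[setU/set0]_(j < p) F j.
  rewrite -bigcup_mkord; apply/seteqP; split => w /=.
    by move=> pw [j /= jp Xw]; rewrite /F /= in Xw; rewrite Xw leqNgt jp in pw.
  by move=> h; rewrite leqNgt; apply/negP => Xp; apply: h; exists (X w).
rewrite probability_setC; last exact: bigsetU_measurable.
rewrite measure_bigsetU // (eq_bigr (fun=> (p%:R^-1)%:E)); last first.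
  by move=> j _; exact: uX.
rewrite sumEFin sumr_const card_ord -(mulr_natr p%:R^-1) mulVf ?subee //.
by rewrite pnatr_eq0 -lt0n.
Qed.

End MeasureFacts.

Section Atoms.
Context {d : measure_display} {T : measurableType d} {R : realType}.
Context (P : probability T R) (q m : nat).
Local Notation p := q.+1.
Variables (x : 'cV[R]_p) (U : 'I_m -> {RV P >-> nat}) (Y : 'I_p -> {RV P >-> nat}).
Hypothesis U_iid : iid_uniform p U.
Hypothesis Y_poisson : cond_indep_poisson x U Y.
Implicit Types (t : m.-tuple 'I_p) (y : 'I_p -> nat).

Definition U_event t : set T := [set w | forall i, U i w = reading t i].

Definition Y_event y : set T := [set w | forall l, Y l w = y l].

Lemma U_eventE t :
  U_event t = \bigcap_(i in [set` [set: 'I_m]%SET]) (U i @^-1` [set reading t i]).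
Proof.
by apply/seteqP; split => w h i //=; apply: h; rewrite /= inE.
Qed.

Lemma Y_eventE y :
  Y_event y = \bigcap_(l in [set` [set: 'I_p]%SET]) (Y l @^-1` [set y l]).
Proof.
by apply/seteqP; split => w h i //=; apply: h; rewrite /= inE.
Qed.

Lemma U_event_measurable t : measurable (U_event t).
Proof.
rewrite U_eventE; apply: fin_bigcap_measurable => // i _.
exact: preimage_nat_measurable.
Qed.

Lemma Y_event_measurable y : measurable (Y_event y).
Proof.
rewrite Y_eventE; apply: fin_bigcap_measurable => // i _.
exact: preimage_nat_measurable.
Qed.

Lemma prob_U_event t : P (U_event t) = (p%:R ^- m)%:E.
Proof.
have [unif indep] := U_iid.
rewrite U_eventE indep // (eq_bigr (fun=> (p%:R^-1)%:E)); last first.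
  by move=> i _; exact: (unif i _ (ltn_ord (tnth t i))).
by rewrite prodEFin prodr_const cardsT card_ord exprVn.
Qed.

Lemma poisson_prob_set1 (r : R) j :
  poisson_prob r 0%N [set j] = (poisson_mass r j)%:E.
Proof. by rewrite /poisson_mass fineK // fin_num_measure. Qed.

(** The conditional law given [U = t] only determines [P] because the event
[U = t] has positive probability; the conditional law then multiplies the
uniform mass [p ^- m]. *)
Lemma prob_atom t y :
  P (Y_event y `&` U_event t) =
  (p%:R ^- m * \prod_l poisson_mass (rate t (fun v => x v 0) l) (y l))%:E.
Proof.
have E0 : 0 < (p%:R ^- m : R) by rewrite invr_gt0 exprn_gt0.
have [] := @Y_poisson (reading t).
  by rewrite -/(U_event t) prob_U_event lte_fin.
rewrite -/(U_event t) => indep law.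
have := indep [set: 'I_p]%SET (fun l => [set y l]) (fun=> Logic.I).
rewrite -Y_eventE (eq_bigr _ (fun l _ => law l [set y l])).
under eq_bigr do rewrite poisson_prob_set1 conv_mxE.
rewrite prodEFin /cond_prob prob_U_event /= => -[h].
rewrite -[LHS]fineK; last first.
  rewrite fin_num_measure //; apply: measurableI.
    exact: Y_event_measurable.
  exact: U_event_measurable.
congr EFin; rewrite mulrC; apply: (canRL (divfK (lt0r_neq0 E0))).
by rewrite h; apply: eq_bigl => l; rewrite inE.
Qed.

End Atoms.

(** * Total mass of the bad atoms *)

Section BadMass.
Context {R : realType} (q m : nat).
Local Notation p := q.+1.
Local Notation L := (ln (p%:R : R)).
Local Notation mR := (m%:R : R).
Variable x : 'cV[R]_p.
Hypothesis x_ge0 : forall v, 0 <= x v 0.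
Hypothesis L_ge1 : 1 <= L.
Hypothesis m_ge1 : (0 < m)%N.
Hypothesis m_le_half_p : mR <= p%:R / 2.
Hypothesis L3_le_m : 122 * L ^+ 3 <= mR.
Hypothesis L2p_le_m2 : 256 * L ^+ 2 * p%:R <= mR ^+ 2.
Implicit Types (t : m.-tuple 'I_p) (y : 'I_p -> nat) (k : 'I_p).

Let law t l : R := rate t (fun v => x v 0) l.
Let bound t : R := Bmax p (reading t) ^+ 2.
Let mean t k : R := \sum_l weight t k l * law t l.
Let stat t y k : R := \sum_l weight t k l * (y l)%:R.

Definition values K (y : {ffun 'I_p -> 'I_K}) : 'I_p -> nat := fun l => y l.

Definition concentrated t y := [forall k,
  (mean t k / 2 - 4 * bound t * L < stat t y k) &&
  (stat t y k < 2 * mean t k + 4 * bound t * L)].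

Lemma sum_exists_le (I S : finType) (Q : S -> pred I) (f : I -> R) :
  (forall i, 0 <= f i) ->
  \sum_(i | [exists s, Q s i]) f i <= \sum_s \sum_(i | Q s i) f i.
Proof.
move=> f0; under [leRHS]eq_bigr do rewrite big_mkcond.
rewrite exchange_big big_mkcond /=; apply: ler_sum => i _.
have g0 s : 0 <= (if Q s i then f i else 0) by case: ifP.
case: ifP => [/existsP[s Qs]|_]; last exact: sumr_ge0.
by rewrite (bigD1 s) //= Qs lerDl sumr_ge0.
Qed.

Local Notation pr_Y t y := (\prod_l poisson_mass (law t l) (y l)).

Lemma pr_Y_ge0 t y : 0 <= pr_Y t y.
Proof. by apply: prodr_ge0 => l _; exact: poisson_mass_ge0. Qed.

Lemma law_ge0 t l : 0 <= law t l.
Proof. exact: rate_ge0. Qed.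

(** The truncated product law is a subprobability: Chernoff's bound with a zero
linear form. *)
Lemma sum_pr_Y_le1 t K : \sum_(y : {ffun 'I_p -> 'I_K}) pr_Y t y <= 1.
Proof.
have := @poisson_exp_tail R _ (law t) (fun=> 0) K (law_ge0 t) 0 0.
under eq_bigl do rewrite mul0r lexx.
move/le_trans; apply; rewrite subr0 big1 ?expR0 // => i _.
by rewrite mul0r expR0 subrr mulr0.
Qed.

(** A union bound over the [2 p] tails, two for each [k], of probability [p^-2]
each. *)
Lemma deviation_rare t K :
  \sum_(y : {ffun 'I_p -> 'I_K} | ~~ concentrated t (values y)) pr_Y t y <= 2 / p%:R.
Proof.
have p0 : 0 < p%:R :> R by [].
have b0 : 0 < bound t.
  rewrite exprn_gt0 //; apply: lt_le_trans (Bmax_ge m_ge1 m_le_half_p t).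
  by rewrite invr_gt0 mulr_gt0 // ltr0n.
have wb k l : 0 <= (weight t k l : R) <= bound t.
  by rewrite weight_ge0 weight_le_sqr_Bmax.
have e2 : expR (- (2 * L)) = p%:R^-1 ^+ 2.
  by have := @expRN2L R 'I_p; rewrite card_ord.
have lo k := @poisson_lower_tail R _ (law t) (weight t k) K (law_ge0 t) _ b0 (wb k) L.
have up k := @poisson_upper_tail R _ (law t) (weight t k) K (law_ge0 t) _ b0 (wb k) L.
have prod_ge0 (y : {ffun 'I_p -> 'I_K}) : 0 <= pr_Y t y by exact: pr_Y_ge0.
pose Qlo k (y : {ffun 'I_p -> 'I_K}) := stat t (values y) k <= mean t k / 2 - 4 * bound t * L.
pose Qup k (y : {ffun 'I_p -> 'I_K}) := 2 * mean t k + 4 * bound t * L <= stat t (values y) k.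
pose Q (s : bool * 'I_p) := if s.1 then Qlo s.2 else Qup s.2.
apply: (@le_trans _ _ (\sum_(y : {ffun 'I_p -> 'I_K} | [exists s, Q s y]) pr_Y t y)).
  rewrite big_mkcond [leRHS]big_mkcond /=; apply: ler_sum => y _.
  case: ifP => [|_]; last by case: ifP.
  case/forallPn => k; rewrite negb_and -!leNgt => /orP h.
  rewrite ifT //; apply/existsP.
  by case: h => h; [exists (true, k)|exists (false, k)].
apply: le_trans (sum_exists_le _ prod_ge0) _.
apply: (@le_trans _ _ (\sum_(s : bool * 'I_p) p%:R^-1 ^+ 2)).
  apply: ler_sum => -[[] k] _; rewrite -e2 /Q /=; [exact: lo|exact: up].
rewrite sumr_const card_prod card_bool card_ord -(mulr_natl (p%:R^-1 ^+ 2)) natrM.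
by rewrite expr2 mulrA -(mulrA 2) mulfV ?gt_eqF // mulr1.
Qed.

(** The mass splits into [8 / p] for configurations that are not well spread and
[2 / p] for deviations of the Poisson sums. *)
Lemma bad_mass_le K :
  \sum_(j : m.-tuple 'I_p * {ffun 'I_p -> 'I_K} |
          ~~ (@well_spread R 'I_p m j.1 && concentrated j.1 (values j.2)))
     p%:R ^- m * pr_Y j.1 (j.2) <= 10 / p%:R.
Proof.
have p0 : 0 < p%:R :> R by [].
have pm0 : 0 < p%:R ^- m :> R by rewrite invr_gt0 exprn_gt0.
rewrite -(pair_big_dep predT (fun t (y : {ffun 'I_p -> 'I_K}) =>
   ~~ (@well_spread R 'I_p m t && concentrated t (values y)))
   (fun t (y : {ffun 'I_p -> 'I_K}) => p%:R ^- m * pr_Y t y)) /=.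
apply: (@le_trans _ _ (\sum_(t : m.-tuple 'I_p)
   (p%:R ^- m * (~~ @well_spread R 'I_p m t)%:R + p%:R ^- m * (2 / p%:R)))).
  apply: ler_sum => t _; rewrite -mulr_sumr -mulrDr ler_pM2l //.
  case: (boolP (well_spread m t)) => spread; rewrite ?mulr1n ?mulr0n ?add0r /=.
    exact: deviation_rare.
  by apply: (le_trans (sum_pr_Y_le1 t K)); rewrite lerDl divr_ge0.
rewrite big_split /= -mulr_sumr sumr_const card_tuple card_ord.
have bad : \sum_(t : m.-tuple 'I_p) (~~ @well_spread R 'I_p m t)%:R <=
    p%:R ^+ m * (8 / p%:R) :> R.
  have := @well_spread_likely R 'I_p m; rewrite card_ord.
  move=> /(_ L_ge1 _ L3_le_m L2p_le_m2) h; apply: le_trans (h _); last first.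
    apply: le_trans m_le_half_p _; lra.
  rewrite -sum1_card natr_sum [leRHS]big_mkcond /=.
  apply: ler_sum => t _; rewrite inE; by case: ifP => // ->.
have -> : 10 / p%:R = p%:R ^- m * (p%:R ^+ m * (8 / p%:R)) + 2 / p%:R :> R.
  by rewrite mulrA mulVf ?mul1r ?expf_neq0 ?gt_eqF //; ring.
apply: lerD; first by rewrite ler_pM2l.
by rewrite -(mulr_natl (p%:R ^- m * _)) natrX mulrA mulfV ?mul1r // expf_neq0 // gt_eqF.
Qed.

End BadMass.

(** * The scales of p, its logarithm and its square root *)

Section Scales.
Context {R : realType} (p : nat).
Local Notation L := (ln (p%:R : R)).

Lemma ln_ge1 : (5 <= p)%N -> 1 <= L.
Proof.
move=> p5; rewrite -[leLHS]expRK ler_ln ?posrE ?expR_gt0 //; last first.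
  by rewrite ltr0n (leq_trans _ p5).
by apply: (le_trans expR1_le4); rewrite ler_nat (leq_trans _ p5).
Qed.

(** Apply [ln s <= s] to the fourth root [s] of [p]. *)
Lemma ln_sqr_le : (0 < p)%N -> 0 <= L -> L ^+ 2 <= 16 * Num.sqrt (p%:R : R).
Proof.
move=> p0 L0.
set r := Num.sqrt (p%:R : R).
have r0 : 0 < r by rewrite sqrtr_gt0 ltr0n.
set s := Num.sqrt r.
have s0 : 0 < s by rewrite sqrtr_gt0.
have sr : s ^+ 2 = r by rewrite sqr_sqrtr // ltW.
have ps : p%:R = s ^+ 4 :> R.
  by rewrite -[4%N]/(2 * 2)%N exprM sr sqr_sqrtr.
have Ls : L = 4 * ln s by rewrite ps lnXn // mulr_natl.
have lns : ln s <= s.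
  have := expR_ge1Dx (ln s); rewrite lnK ?posrE //; lra.
have L4 : L <= 4 * s by lra.
rewrite -sr; nra.
Qed.

End Scales.

(** * The event and its probability *)

Section Coverage.
Context {d : measure_display} {T : measurableType d} {R : realType}.
Context (P : probability T R) (q m : nat).
Local Notation p := q.+1.
Variables (x : 'cV[R]_p) (U : 'I_m -> {RV P >-> nat}) (Y : 'I_p -> {RV P >-> nat}).
Hypothesis U_iid : iid_uniform p U.
Hypothesis Y_poisson : cond_indep_poisson x U Y.

Lemma joint_truncation (e : R) : 0 < e ->
  exists K, (\sum_l P (Y l @^-1` [set j | (K.+1 <= j)%N]) <= e%:E)%E.
Proof.
move=> e0.
have e1 : 0 < e / p%:R by rewrite divr_gt0.
have /choice[Kf HK] l := nat_RV_tail (Y l) e1.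
exists (\max_l Kf l)%N.
apply: (@le_trans _ _ (\sum_(l < p) (e / p%:R)%:E)%E).
  apply: lee_sum => l _; apply: le_trans (HK l).
  apply: le_measure; rewrite ?inE; try exact: preimage_nat_measurable.
  move=> w /=; apply: leq_trans; rewrite ltnW // ltnS; exact: leq_bigmax.
rewrite sumEFin sumr_const card_ord lee_fin -(mulr_natr (e / p%:R)).
by rewrite divfK // pnatr_eq0.
Qed.

(** Every outcome lies in an atom, unless some [U i] or [Y l] is out of range; so
the good atoms miss at most the mass of the bad ones and of the outliers.
Subadditivity suffices: the atoms need not be compared with each other. *)
Lemma prob_good_atoms K (good : pred (m.-tuple 'I_p * {ffun 'I_p -> 'I_K.+1})) e f :
  (\sum_l P (Y l @^-1` [set j | (K.+1 <= j)%N]) <= e%:E)%E ->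
  \sum_(j | ~~ good j) p%:R ^- m *
     \prod_l poisson_mass (rate j.1 (fun v => x v 0) l) (j.2 l) <= f ->
  ((1 - (f + e))%:E <=
   P (\big[setU/set0]_(j | good j) (Y_event Y (values j.2) `&` U_event U j.1)))%E.
Proof.
move=> he hf.
pose atom (j : m.-tuple 'I_p * {ffun 'I_p -> 'I_K.+1}) :=
  Y_event Y (values j.2) `&` U_event U j.1.
have matom j : measurable (atom j).
  by apply: measurableI; [exact: Y_event_measurable|exact: U_event_measurable].
pose outU i := U i @^-1` [set j | (p <= j)%N].
pose outY l := Y l @^-1` [set j | (K.+1 <= j)%N].
have mU i : measurable (outU i) by exact: preimage_nat_measurable.
have mY i : measurable (outY i) by exact: preimage_nat_measurable.
pose G := \big[setU/set0]_(j | good j) atom j.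
pose B := \big[setU/set0]_(j | ~~ good j) atom j.
pose VU := \big[setU/set0]_i outU i.
pose VY := \big[setU/set0]_i outY i.
have mG : measurable G by exact: bigsetU_measurable.
have mB : measurable B by exact: bigsetU_measurable.
have mVU : measurable VU by exact: bigsetU_measurable.
have mVY : measurable VY by exact: bigsetU_measurable.
have cov : G `|` (B `|` (VU `|` VY)) = setT.
  rewrite -subTset => w _.
  have [/existsP[i hi]|/existsPn hU] := boolP [exists i, (p <= U i w)%N].
    by right; right; left; apply/in_finite_bigsetU; exists i.
  have [/existsP[i hi]|/existsPn hY] := boolP [exists i, (K.+1 <= Y i w)%N].
    by right; right; right; apply/in_finite_bigsetU; exists i.
  pose j := ([tuple inord (U i w) | i < m] : m.-tuple 'I_p,
             [ffun l => inord (Y l w)] : {ffun 'I_p -> 'I_K.+1}).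
  have jw : atom j w.
    split => [l|i] /=.
      by rewrite /values /= ffunE inordK // ltnNge.
    by rewrite /reading /= tnth_mktuple inordK // ltnNge.
  case: (boolP (good j)) => gj; [left|right; left];
    by apply/in_finite_bigsetU; exists j.
have hB : (P B <= f%:E)%E.
  apply: (le_trans (measure_bigsetU_le _ _ _ matom)).
  under eq_bigr do rewrite /atom (prob_atom U_iid Y_poisson).
  by rewrite sumEFin lee_fin.
have hVU : (P VU <= 0)%E.
  apply: (le_trans (measure_bigsetU_le _ _ _ mU)).
  rewrite big1 // => i _; apply: uniform_below_out => //.
  by have [] := U_iid.
have hVY : (P VY <= e%:E)%E.
  exact: (le_trans (measure_bigsetU_le _ _ _ mY)).
have : (1 <= P G + (f%:E + (0 + e%:E)))%E.
  rewrite -(probability_setT P) -cov.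
  apply: le_trans (measureU2 _ _ _) _ => //; first by do 2 apply: measurableU => //.
  apply: leeD => //; apply: le_trans (measureU2 _ _ _) _ => //.
    exact: measurableU.
  apply: leeD => //; apply: le_trans (measureU2 _ _ _) _ => //.
  exact: leeD.
have fG : P G \is a fin_num by exact: fin_num_measure.
rewrite -/G -(fineK fG) add0e -!EFinD !lee_fin; lra.
Qed.

End Coverage.


Theorem proposition14 (R : realType) :
  exists kappa1 kappa2 c1 c2 C : R,
    [/\ 0 < kappa1, 0 < kappa2, 0 < c1, 0 < c2 & 0 < C] /\
    forall (p m s : nat) (x : 'cV[R]_p)
      (d : measure_display) (T : measurableType d) (P : probability T R)
      (U : 'I_m -> {RV P >-> nat}) (Y : 'I_p -> {RV P >-> nat}),
    let L := ln (p%:R : R) in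
    (1 <= s)%N -> (s < minn m p)%N ->
    (forall k, 0 <= x k 0) -> sparse s x ->
    iid_uniform p U -> cond_indep_poisson x U Y ->
    (5 <= p)%N ->
    kappa1 * L * Num.sqrt p%:R <= m%:R ->
    m%:R <= kappa2 * p%:R * L^-1 ->
    exists Omega : set T,
      [/\ measurable Omega,
          ((1 - C / p%:R)%:E < P Omega)%E &
          forall w, Omega w -> forall k : 'I_p,
            let dk := dweight R (fun i => U i w) (fun l => Y l w) k in
            let Sk := \sum_(v < p | v != k) x v 0 in
            c1 * (x k 0 * L / m%:R + L / p%:R * Sk + L ^+ 2 / m%:R ^+ 2)
              <= dk ^+ 2 /\
            dk ^+ 2 <=
            c2 * (x k 0 * L / m%:R + L ^+ 2 / p%:R * Sk
                  + L ^+ 4 / m%:R ^+ 2)].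
Proof.
(* [2000] is [122 * 16] rounded up: the sum of cubes needs [122 * L^3 <= m], and
   [L^2 <= 16 * sqrt p].  The failures add up to [11 / p]: [10 / p] for the bad
   atoms and [1 / p] for the truncation of [Y]. *)
exists 2000, 2^-1, 256^-1, 1000, 12; split.
  by rewrite !invr_gt0 !ltr0n.
case=> [|q] m s x d T P U Y L _ _ x0 _ U_iid Y_poisson p5 // hm1 hm2.
have L1 : 1 <= L by exact: ln_ge1.
have p0 : 0 < q.+1%:R :> R by [].
have Lpos : 0 < L by apply: lt_le_trans L1.
set r := Num.sqrt (q.+1%:R : R) in hm1.
have r0 : 0 < r by rewrite sqrtr_gt0.
have rp : r ^+ 2 = q.+1%:R by rewrite sqr_sqrtr // ltW.
have L2r : L ^+ 2 <= 16 * r by apply: ln_sqr_le => //; exact: ltW.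
have Lr0 : 0 < L * r by rewrite mulr_gt0.
have k0 : 0 < 2000 :> R by rewrite ltr0n.
have kLr0 : 0 < 2000 * L * r by rewrite -mulrA; exact: mulr_gt0.
have m0 : 0 < m%:R :> R by exact: lt_le_trans hm1.
have m1 : (0 < m)%N by rewrite -(ltr0n R).
have mp : m%:R <= q.+1%:R / 2 :> R.
  apply: (le_trans hm2); rewrite (mulrC 2^-1).
  by apply: ler_piMr; [rewrite divr_ge0|rewrite invf_le1].
have L3m : 122 * L ^+ 3 <= m%:R.
  apply: le_trans hm1; rewrite exprS.
  have := ler_wpM2l (ltW Lpos) L2r; lra.
have L2pm : 256 * L ^+ 2 * q.+1%:R <= m%:R ^+ 2 :> R.
  apply: (@le_trans _ _ ((2000 * L * r) ^+ 2)).
    by rewrite -rp !exprMn !ler_wpM2r ?sqr_ge0 //; lra.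
  by rewrite ler_sqr ?nnegrE ?(ltW m0) ?(ltW kLr0).
have ip0 : 0 < q.+1%:R^-1 :> R by rewrite invr_gt0.
have [K trunc] := joint_truncation Y ip0.
pose good (j : m.-tuple 'I_q.+1 * {ffun 'I_q.+1 -> 'I_K.+1}) :=
  @well_spread R 'I_q.+1 m j.1 && concentrated x j.1 (values j.2).
have mass := bad_mass_le x0 L1 m1 mp L3m L2pm K.+1.
exists (\big[setU/set0]_(j | good j) (Y_event Y (values j.2) `&` U_event U j.1)).
split.
- apply: bigsetU_measurable => j _.
  by apply: measurableI; [exact: Y_event_measurable|exact: U_event_measurable].
- apply: lt_le_trans (prob_good_atoms U_iid Y_poisson trunc mass).
  by rewrite lte_fin; move: ip0; move: (q.+1%:R^-1) => v v0; lra.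
- move=> w /in_finite_bigsetU[j /andP[spread /forallP conc] [Yw Uw]] k.
  have -> : (fun i => U i w) = reading j.1 by apply/funext.
  have -> : (fun l => Y l w) = values j.2 by apply/funext.
  have /andP[/ltW lo /ltW up] := conc k.
  exact: dweight_bounds.
Qed.
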